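(* For each $t\in\{2,\dots,T\}$ and $\nu\in[|\mathcal S_t|]$, let the risk spectrum $\sigma_{s_{t,\nu}}\in\mathscr G$ be Lipschitz continuous with modulus bounded by $L_\nu$, and let $\hat\sigma_{s_{t,\nu}}$ be a projection of $\sigma_{s_{t,\nu}}$ onto $\mathscr G_J$. Suppose that for each $t\in[T]$ there is a positive function $\Phi_t:[0,1]\to\mathbb{R}_+$ with $\int_0^1\Phi_t(z)\,dz<+\infty$ such that $$\big|F^{\leftarrow}_{\tilde V^R_t(x_{t-1},\xi_t)}(z)\big|\le\Phi_t(z)\quad\text{for all } z\in[0,1]\text{ and all } x_{t-1}\in\mathcal X_{t-1}.$$ Then for every $t\in[T]$, every feasible $x_{t-1}\in\mathcal X_{t-1}$ and every realization of $\xi_t$, $$\big|V^R_t(x_{t-1},\xi_t)-\tilde V^R_t(x_{t-1},\xi_t)\big|\ \le\ \sum_{t'=t+1}^{T}\ \max_{\nu\in[|\mathcal S_{t'}|]}L_\nu\,\beta_J\int_0^1\Phi_{t'}(z)\,dz,$$ where $\beta_J=\max_{j\in\{0,\dots,J\}}(z_{j+1}-z_j)$.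
   Context: Notation: $[n]=\{1,\dots,n\}$; $ab$ is the scalar product of vectors; $F^{\leftarrow}_Z$ is the (left-continuous) quantile function of the random variable $Z$, its value at $0$ being understood as the right limit. Risk spectra. $\mathscr G$ is the set of nonnegative, nondecreasing $\sigma\in L^1[0,1]$ with $\int_0^1\sigma=1$. Fix breakpoints $0=z_0<z_1<\dots<z_{J+1}=1$; $\mathscr G_J\subset\mathscr G$ is the subset of step functions with these breakpoints. A projection of $\sigma\in\mathscr G$ onto $\mathscr G_J$ is a $\sigma_J\in\mathscr G_J$ with $\sigma_J(z)=\sigma_j$ on $[z_j,z_{j+1})$, $\sigma_j\in[\sigma(z_j),\sigma(z_{j+1})]$ for $j=0,\dots,J$, and $\sum_{j=0}^J\sigma_j(z_{j+1}-z_j)=1$. Problem data. $T>1$ stages. For $t\in[T]$, $\xi_t=(c_t,b_t,A_t,E_t)$ is random with finitely many realizations; $\xi_1$ is deterministic and $\xi_1,\dots,\xi_T$ are independent. $\mathcal X_1(x_0,\xi_1)=\{x_1\in\mathbb{R}^{n_1}_+:A_1x_1=b_1\}$ and $\mathcal X_t(x_{t-1},\xi_t)=\{x_t\in\mathbb{R}^{n_t}_+:A_tx_t=b_t-E_tx_{t-1}\}$, $t\ge2$; these are nonempty and compact for every realization of $\xi_t$ and every feasible $x_{t-1}$. $\mathcal X_t$ denotes the set of feasible $x_t$, i.e. those in $\mathcal X_t(x_{t-1},\xi_t)$ for some realization $\xi_t$ and some feasible $x_{t-1}$; $\mathcal X_0=\{x_0\}$. Preferences. For $t\ge2$ the preference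 parameter $s_t$ has finite support $\mathcal S_t=\{s_{t,\nu}:\nu\in[|\mathcal S_t|]\}\subset\mathbb{R}^{d_s}$, and the nonempty ambiguity set of its distribution is $$\mathcal{Q}_{t}=\Big\{q\in\mathbb{R}_+^{|\mathcal S_{t}|}:\ \sum_{\nu}q_\nu=1,\ \sum_\nu q_\nu s_{t,\nu}=\mu_{t},\ \sum_\nu q_\nu(s_{t,\nu}-\mu_{t})(s_{t,\nu}-\mu_{t})^\top=\Sigma_{t}\Big\}.$$ For $q\in\mathcal Q_t$ the average randomized spectral risk measures with the general and with the step-like spectra are $$\tilde\rho_{q}(Z)=\sum_\nu q_\nu\int_0^1F^{\leftarrow}_Z(z)\sigma_{s_{t,\nu}}(z)\,dz,\qquad \rho_{q}(Z)=\sum_\nu q_\nu\int_0^1F^{\leftarrow}_Z(z)\hat\sigma_{s_{t,\nu}}(z)\,dz.$$ Cost-to-go functions. $V^R_{T+1}=\tilde V^R_{T+1}\equiv0$ and, for $t=T,\dots,1$ (the risk term being absent for $t=T$), $$V^R_t(x_{t-1},\xi_t)=\min_{x_t\in\mathcal X_t(x_{t-1},\xi_t)}\Big\{c_tx_t+\max_{q\in\mathcal Q_{t+1}}\rho_{q}\big(V^R_{t+1}(x_t,\xi_{t+1})\big)\Big\},$$ $$\tilde V^R_t(x_{t-1},\xi_t)=\min_{x_t\in\mathcal X_t(x_{t-1},\xi_t)}\Big\{c_tx_t+\max_{q\in\mathcal Q_{t+1}}\tilde\rho_{q}\big(\tilde V^R_{t+1}(x_t,\xi_{t+1})\big)\Big\},$$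 where $\rho_q,\tilde\rho_q$ are evaluated with respect to the distribution of $\xi_{t+1}$ for fixed $x_t$. *)

(* Defs.v *)
From HB Require Import structures.
From mathcomp Require Import all_boot all_order all_algebra.
From mathcomp Require Import all_classical all_reals all_analysis.

Set Implicit Arguments.
Unset Strict Implicit.
Unset Printing Implicit Defensive.

Import Order.TTheory GRing.Theory Num.Theory.
Import numFieldNormedType.Exports.

Local Open Scope classical_set_scope.
Local Open Scope ring_scope.

Section RandomElements.
Context {d : measure_display} {Omega : measurableType d} {R : realType}.
Variable P : probability Omega R.

Definition finitely_valued {U : Type} (X : Omega -> U) : Prop :=
  finite_set (range X) /\ forall u : U, measurable (X @^-1` [set u]).

Definition realizations {U : Type} (X : Omega -> U) : set U := range X.

(* Mutual independence of X_1, ..., X_T.  Taking B t = setT gives the product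
   rule for subfamilies; the B t are arbitrary because, for finitely valued
   X t, the preimage of every set is measurable. *)
Definition independent_upto (T : nat) (U : nat -> Type)
    (X : forall t, Omega -> U t) : Prop :=
  forall B : forall t, set (U t),
    P (\bigcap_(t in [set t | (1 <= t <= T)%N]) (X t @^-1` B t)) =
    (\prod_(1 <= t < T.+1) P (X t @^-1` B t))%E.

(* For 0 < z <= 1 this is the left-continuous inverse of the distribution
   function of Z; on 0 < z <= 1 and for finitely valued Z the set below is
   nonempty and bounded below, so that the real-valued [inf] is meaningful. *)
Definition left_quantile (Z : Omega -> R) (z : R) : R :=
  inf [set y : R | (z%:E <= P [set w | (Z w <= y)%R])%E].

Definition quantile (Z : Omega -> R) (z : R) : R :=
  if z == 0 then lim (left_quantile Z u @[u --> 0^'+]) else left_quantile Z z.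

Definition spectral_risk (sg : R -> R) (Z : Omega -> R) : R :=
  \int[lebesgue_measure]_(z in `[0, 1]) (quantile Z z * sg z).

Definition avg_spectral_risk (N : nat) (q : 'I_N -> R) (sg : 'I_N -> R -> R)
    (Z : Omega -> R) : R :=
  \sum_(nu < N) q nu * spectral_risk (sg nu) Z.

End RandomElements.

Section Spectra.
Context {R : realType}.

Definition risk_spectrum (sg : R -> R) : Prop :=
  [/\ forall u : R, u \in `[0, 1] -> 0 <= sg u,
      forall u v : R, u \in `[0, 1] -> v \in `[0, 1] -> u <= v -> sg u <= sg v,
      lebesgue_measure.-integrable `[0, 1] (EFin \o sg)
    & \int[lebesgue_measure]_(u in `[0, 1]) sg u = 1].

Definition breakpoints (J : nat) (z : nat -> R) : Prop :=
  [/\ z 0%N = 0, z J.+1 = 1 & forall j, (j <= J)%N -> z j < z j.+1].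

Definition is_step (J : nat) (z : nat -> R) (sg : R -> R) (a : nat -> R) :
    Prop :=
  forall j, (j <= J)%N -> forall u : R, u \in `[z j, z j.+1[ -> sg u = a j.

Definition step_risk_spectrum (J : nat) (z : nat -> R) (sg : R -> R) : Prop :=
  risk_spectrum sg /\ exists a, is_step J z sg a.

Definition spectrum_projection (J : nat) (z : nat -> R) (sg sgJ : R -> R) :
    Prop :=
  step_risk_spectrum J z sgJ /\
  exists a : nat -> R,
    [/\ is_step J z sgJ a,
        forall j, (j <= J)%N -> sg (z j) <= a j <= sg (z j.+1)
      & \sum_(j < J.+1) a j * (z j.+1 - z j) = 1].

(* The default value 0 is harmless: the steps are positive. *)
Definition mesh (J : nat) (z : nat -> R) : R :=
  \big[Num.max/0]_(j < J.+1) (z j.+1 - z j).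

Definition ambiguity_set (N ds : nat) (s : 'I_N -> 'cV[R]_ds)
    (mu : 'cV[R]_ds) (Sigma : 'M[R]_ds) : set ('I_N -> R) :=
  [set q | [/\ forall nu, 0 <= q nu,
               \sum_(nu < N) q nu = 1,
               \sum_(nu < N) q nu *: s nu = mu
             & \sum_(nu < N) q nu *: ((s nu - mu) *m (s nu - mu)^T) = Sigma]].

End Spectra.

(* The data (c_t, b_t, A_t, E_t) of a stage with m constraints and n decision
   variables, preceded by a stage with n' decision variables. *)
Record stage_data (R : realType) (m n' n : nat) := StageData {
  cost : 'rV[R]_n;
  rhs : 'cV[R]_m;
  recourse : 'M[R]_(m, n);
  technology : 'M[R]_(m, n')
}.

Section Program.
Context {d : measure_display} {Omega : measurableType d} {R : realType}.
Variable P : probability Omega R.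
(* Stage t has m t constraints and n t variables; n 0 is the dimension of the
   initial state.  Only the stages t >= 1 matter. *)
Variables m n : nat -> nat.
Variable xi : forall t, Omega -> stage_data R (m t) (n t.-1) (n t).

(* The first stage has no technology term. *)
Definition feasible_set (t : nat) (x : 'cV[R]_(n t.-1))
    (v : stage_data R (m t) (n t.-1) (n t)) : set 'cV[R]_(n t) :=
  [set y : 'cV[R]_(n t) | (forall i, 0 <= y i 0) /\
     recourse v *m y = if t == 1%N then rhs v else rhs v - technology v *m x].

Fixpoint feasible (x0 : 'cV[R]_(n 0%N)) (t : nat) : set 'cV[R]_(n t) :=
  match t with
  | 0%N => [set x0]
  | t'.+1 => [set y | exists2 x, @feasible x0 t' x &
                exists2 v, realizations (xi t'.+1) v &
                  @feasible_set t'.+1 x v y]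
  end.

Variables (N : nat -> nat) (ds : nat).
Variable s : forall t, 'I_(N t) -> 'cV[R]_ds.
Variable Q : forall t, set ('I_(N t) -> R).
Variable sg : 'cV[R]_ds -> R -> R.

Definition worst_case_risk (t : nat) (Z : Omega -> R) : R :=
  sup [set avg_spectral_risk P q (fun nu => sg (s nu)) Z | q in @Q t].

(* [cost_to_go_from r t] is the cost-to-go function at stage t when r stages,
   t included, remain; hence [r' == 0] singles out the last stage, which has no
   risk term.  The minimum and the maximum are rendered by the real [inf] and
   [sup].  These have their junk value 0 only on empty or unbounded sets, which
   do not arise for nonempty compact feasible sets and nonempty ambiguity sets
   when the cost-to-go of the next stage is bounded on the feasible
   decisions. *)
Fixpoint cost_to_go_from (r t : nat) :
    'cV[R]_(n t.-1) -> stage_data R (m t) (n t.-1) (n t) -> R :=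
  match r with
  | 0%N => fun _ _ => 0
  | r'.+1 => fun x v =>
      inf [set (cost v *m y) 0 0 +
               (if r' == 0%N then 0 else
                worst_case_risk t.+1
                  (fun w => @cost_to_go_from r' t.+1 y (xi t.+1 w)))
          | y in @feasible_set t x v]
  end.

Definition cost_to_go (T t : nat) :
    'cV[R]_(n t.-1) -> stage_data R (m t) (n t.-1) (n t) -> R :=
  @cost_to_go_from (T.+1 - t) t.

Lemma cost_to_go_end (T : nat) x v : @cost_to_go T T.+1 x v = 0.
Proof. by rewrite /cost_to_go subnn. Qed.

Lemma cost_to_go_last (T : nat) x v :
  @cost_to_go T T x v = inf [set (cost v *m y) 0 0 | y in @feasible_set T x v].
Proof.
rewrite /cost_to_go subSnn /=; congr (inf _).
by apply: eq_imagel => y _; rewrite addr0.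
Qed.

Lemma cost_to_go_rec (T t : nat) x v : (t < T)%N ->
  @cost_to_go T t x v =
  inf [set (cost v *m y) 0 0 +
           worst_case_risk t.+1 (fun w => @cost_to_go T t.+1 y (xi t.+1 w))
      | y in @feasible_set t x v].
Proof.
move=> tT; rewrite /cost_to_go subSS subSn 1?ltnW //=.
by rewrite subn_eq0 leqNgt tT.
Qed.

End Program.

(* Main.v *)
Require Import Defs.
From HB Require Import structures.
From mathcomp Require Import all_boot all_order all_algebra.
From mathcomp Require Import all_classical all_reals all_analysis.
From mathcomp Require Import lra.

(** Write eps_t for (max_nu L_nu) * beta_J * int Phi_t.  The bound follows by
    backward induction on the stage: replacing the spectra costs at most eps_t
    at each later stage t, and every operation of the recursion propagates an
    error made later without amplifying it.

    The new error at one stage comes from two facts.  On a cell [z_j, z_{j+1})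
    both a spectrum and its projection take values between sigma(z_j) and
    sigma(z_{j+1}), which are at most L * beta_J apart
    ([spectrum_projection_dist]).  Integrating this against the quantile
    function, whose modulus is at most Phi_t, bounds the change of the spectral
    risk of a fixed cost ([spectral_risk_spectrum_dist]).

    The error inherited from the next stage is not amplified because each map
    on the way is 1-Lipschitz for the uniform distance: a cost goes to its
    quantile function ([left_quantile_dist]), then to its spectral risk, since
    a spectrum has integral 1 ([spectral_risk_dist]), then to an average over
    preferences ([dist_convex_sum]), then to a maximum over the ambiguity set
    and a minimum over decisions ([dist_sup_image], [dist_inf_image]).

    Infima and suprema over sets of reals, with value 0 on sets where they do
    not exist, obey this last estimate in all cases: of two families at finite
    uniform distance either both are bounded on the relevant side, or neither
    is and both optimal values are 0.  Finiteness of the ranges of the data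
    makes all costs measurable and bounded random variables, hence their
    quantile functions bounded and monotone on ]0, 1], and all the integrals
    meaningful. *)

Set Implicit Arguments.
Unset Strict Implicit.
Unset Printing Implicit Defensive.

Import Order.TTheory GRing.Theory Num.Theory.
Import numFieldNormedType.Exports.

Local Open Scope classical_set_scope.
Local Open Scope ring_scope.

(** * Optimal values under uniform perturbation *)

Section OptimalValues.
Context {R : realType}.

Lemma inf_shift_le (A B : set R) (e : R) :
  has_lbound A -> B !=set0 ->
  (forall b, B b -> exists2 a, A a & a <= b + e) ->
  has_lbound B /\ inf A - e <= inf B.
Proof.
move=> lA B0 AB.
have lbB : lbound B (inf A - e).
  move=> b /AB[a Aa ab]; rewrite lerBlDr (le_trans _ ab)//.
  exact: ge_inf.
by split; [exists (inf A - e) | exact: lb_le_inf].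
Qed.

(** If one of the sets is empty or unbounded below, so is the other, and the
    default value 0 of both infima keeps the estimate true. *)
Lemma dist_inf (A B : set R) (e : R) : 0 <= e ->
  (forall a, A a -> exists2 b, B b & b <= a + e) ->
  (forall b, B b -> exists2 a, A a & a <= b + e) ->
  `|inf A - inf B| <= e.
Proof.
move=> e0 AB BA.
have [[A0 lA]|nA] := pselect (has_inf A).
  have B0 : B !=set0 by case: A0 => a /AB[b Bb _]; exists b.
  have [lB h1] := inf_shift_le lA B0 BA.
  have [_ h2] := inf_shift_le lB A0 AB.
  by rewrite ler_norml; apply/andP; split; lra.
have nB : ~ has_inf B.
  move=> [B0 lB]; apply: nA.
  have A0 : A !=set0 by case: B0 => b /BA[a Aa _]; exists a.
  by split => //; have [] := inf_shift_le lB A0 AB.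
by rewrite !inf_out// subrr normr0.
Qed.

Lemma dist_inf_image {T : Type} (D : set T) (f g : T -> R) (e : R) : 0 <= e ->
  (forall y, D y -> `|f y - g y| <= e) ->
  `|inf [set f y | y in D] - inf [set g y | y in D]| <= e.
Proof.
move=> e0 fg; apply: dist_inf => // _ [y Dy <-].
  by exists (g y); [exists y | have := fg _ Dy; rewrite ler_norml => /andP[*]; lra].
by exists (f y); [exists y | have := fg _ Dy; rewrite ler_norml => /andP[*]; lra].
Qed.

Lemma dist_sup_image {T : Type} (D : set T) (f g : T -> R) (e : R) : 0 <= e ->
  (forall y, D y -> `|f y - g y| <= e) ->
  `|sup [set f y | y in D] - sup [set g y | y in D]| <= e.
Proof.
move=> e0 fg.
have supE h : sup [set h y | y in D] = - inf [set - h y | y in D].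
  rewrite /inf opprK; congr sup; apply/seteqP; split => x /=.
    by move=> [y Dy <-]; exists (- h y); [exists y | rewrite opprK].
  by move=> [_ [y Dy <-] <-]; exists y => //; rewrite opprK.
rewrite !supE -opprD normrN; apply: dist_inf_image => // y Dy.
by rewrite -opprD normrN; exact: fg.
Qed.

Lemma dist_convex_sum (N : nat) (q a b : 'I_N -> R) (e : R) :
  (forall i, 0 <= q i) -> \sum_i q i = 1 ->
  (forall i, `|a i - b i| <= e) ->
  `|\sum_i q i * a i - \sum_i q i * b i| <= e.
Proof.
move=> q0 q1 ab; rewrite -sumrB -[leRHS]mul1r -q1 mulr_suml.
apply: (le_trans (ler_norm_sum _ _ _)); apply: ler_sum => i _.
by rewrite -mulrBr normrM ger0_norm// ler_wpM2l.
Qed.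

End OptimalValues.

(** * Finitely valued random elements *)

Section FinitelyValued.
Context {d : measure_display} {Omega : measurableType d}.

Lemma finitely_valued_measurable {U : Type} (X : Omega -> U) (B : set U) :
  finitely_valued X -> measurable (X @^-1` B).
Proof.
move=> [fX mX].
have -> : X @^-1` B = \bigcup_(u in range X `&` B) (X @^-1` [set u]).
  apply/seteqP; split => w /=.
    by move=> Bw; exists (X w) => //; split => //; exists w.
  by move=> [u [_ Bu] /= ->].
by apply: fin_bigcup_measurable => //; exact: finite_setIl.
Qed.

Lemma finitely_valued_comp {U W : Type} (X : Omega -> U) (f : U -> W) :
  finitely_valued X -> finitely_valued (fun w => f (X w)).
Proof.
move=> fX; split; last first.
  by move=> u; exact: (finitely_valued_measurable (f @^-1` [set u]) fX).
rewrite -image_comp; apply: finite_image; exact: fX.1.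
Qed.

End FinitelyValued.

(** * Quantile functions and spectral risk *)

Section Quantile.
Context {d : measure_display} {Omega : measurableType d} {R : realType}.
Variable P : probability Omega R.
Implicit Types (Z : Omega -> R) (u v : R).

Lemma finitely_valued_bounded Z :
  finitely_valued Z -> exists M, forall w, `|Z w| <= M.
Proof.
move=> [/finite_compact/compact_bounded[M [_ ZM]] _].
by exists (M + 1) => w; apply: (ZM (M + 1)); [rewrite ltrDl | exists w].
Qed.

(** The set whose infimum is the left quantile of [Z] at [u]. *)
Let level Z u := [set y : R | (u%:E <= P [set w | (Z w <= y)%R])%E].

Lemma level_lbound Z (M u : R) : (forall w, `|Z w| <= M) -> 0 < u ->
  lbound (level Z u) (- M).
Proof.
move=> ZM u0 y; rewrite /level/=; apply: contraTT; rewrite -!ltNge => yM.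
rewrite (_ : [set w | _] = set0) ?measure0 ?lte_fin//.
rewrite -subset0 => w /= Zy; have := ZM w.
by rewrite ler_norml => /andP[]; lra.
Qed.

Lemma level_top Z (M u : R) : (forall w, `|Z w| <= M) -> u <= 1 ->
  level Z u M.
Proof.
move=> ZM u1; rewrite /level/= (_ : [set w | _] = setT).
  by rewrite probability_setT lee_fin.
by apply/seteqP; split => w //= _; rewrite (le_trans (ler_norm _)).
Qed.

Lemma left_quantile_bounded Z (M u : R) : (forall w, `|Z w| <= M) ->
  0 < u <= 1 -> `|left_quantile P Z u| <= M.
Proof.
move=> ZM /andP[u0 u1]; have lM := level_lbound ZM u0.
have tM := level_top ZM u1.
rewrite ler_norml; apply/andP; split.
  by apply: lb_le_inf => //; exists M.
by apply: ge_inf => //; exists (- M).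
Qed.

(** Adding e to a point of the superlevel set of one variable lands in that of
    the other, because [Z <= y] is included in [Z' <= y + e].  This holds for
    every level u, including those where [inf] has its default value. *)
Lemma left_quantile_dist Z Z' (e u : R) :
  finitely_valued Z -> finitely_valued Z' -> 0 <= e ->
  (forall w, `|Z w - Z' w| <= e) ->
  `|left_quantile P Z u - left_quantile P Z' u| <= e.
Proof.
move=> fZ fZ' e0 ZZ'.
have shift X X' : finitely_valued X -> finitely_valued X' ->
    (forall w, `|X w - X' w| <= e) ->
    forall a, level X u a -> exists2 b, level X' u b & b <= a + e.
  move=> fX fX' XX' a; rewrite /level/= => ua.
  exists (a + e) => //=; apply: (le_trans ua); apply: le_measure.
  - by rewrite inE; exact: (finitely_valued_measurable [set y | y <= a] fX).
  - by rewrite inE; exact: (finitely_valued_measurable [set y | y <= a + e] fX').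
  - by move=> w /= Xa; have := XX' w; rewrite ler_norml => /andP[]; lra.
apply: dist_inf => //; apply: shift => // w.
by rewrite distrC.
Qed.

Lemma left_quantile_homo Z u v : finitely_valued Z ->
  0 < u -> u <= v -> v <= 1 -> left_quantile P Z u <= left_quantile P Z v.
Proof.
move=> fZ u0 uv v1; have [M ZM] := finitely_valued_bounded fZ.
have lu : has_lbound (level Z u) by exists (- M); exact: level_lbound.
have tv : level Z v !=set0 by exists M; exact: level_top.
suff /(inf_shift_le lu tv)[_] : forall b, level Z v b ->
    exists2 a, level Z u a & a <= b + 0 by rewrite subr0.
move=> b vb; exists b; last by rewrite addr0.
by apply: le_trans vb; rewrite lee_fin.
Qed.

(** Monotonicity gives measurability, but the quantile function is monotone on
    ]0, 1] only, its default value being 0 outside. *)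
Lemma measurable_left_quantile Z (D : set R) : finitely_valued Z ->
  measurable D -> D `<=` `]0, 1] -> measurable_fun D (left_quantile P Z).
Proof.
move=> fZ mD D01; have [M ZM] := finitely_valued_bounded fZ.
(* An extension to the whole line that remains nondecreasing. *)
pose g u := if u <= 0 then - M else if u <= 1 then left_quantile P Z u else M.
apply: (@eq_measurable_fun _ _ _ _ D g).
  move=> u /set_mem/D01; rewrite /= in_itv/= /g => /andP[u0 ->].
  by rewrite leNgt u0.
apply: measurable_realfun.nondecreasing_measurable => // u v uv; rewrite /g.
have bnd x : 0 < x -> x <= 1 -> - M <= left_quantile P Z x <= M.
  by move=> x0 x1; rewrite -ler_norml left_quantile_bounded// x0.
have M0 : - M <= M.
  by have := bnd 1 ltr01 (lexx _) => /andP[]; exact: le_trans.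
have [u0|u0] := leP u 0; have [v0|v0] := leP v 0 => //.
- by have [v1|v1] := leP v 1 => //; have /andP[] := bnd _ v0 v1.
- by lra.
have [u1|u1] := leP u 1; have [v1|v1] := leP v 1 => //; last by lra.
  exact: left_quantile_homo.
by have /andP[] := bnd _ u0 u1.
Qed.

Local Notation leb := (@lebesgue_measure R).

Lemma integrable_left_quantile_mul Z (D : set R) (sg : R -> R) :
  finitely_valued Z -> measurable D -> D `<=` `]0, 1] ->
  leb.-integrable D (EFin \o sg) ->
  leb.-integrable D (EFin \o (fun u => left_quantile P Z u * sg u)).
Proof.
move=> fZ mD D01 isg; have [M ZM] := finitely_valued_bounded fZ.
have bq : [bounded left_quantile P Z u | u in D].
  exists M; split; first exact: num_real.
  move=> x Mx u /D01; rewrite /= in_itv/= => u01.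
  exact/(le_trans (left_quantile_bounded ZM u01))/ltW.
have mq := measurable_left_quantile fZ mD D01.
exact: (@integrableMr _ _ _ leb D mD (left_quantile P Z) (EFin \o sg) mq bq isg).
Qed.

Lemma quantileE Z u : 0 < u -> quantile P Z u = left_quantile P Z u.
Proof. by move=> u0; rewrite /quantile gt_eqF. Qed.

Lemma integrable_open01 (f : R -> R) :
  leb.-integrable `[0, 1] (EFin \o f) -> leb.-integrable `]0, 1[ (EFin \o f).
Proof. by apply: integrableS => //; exact: subset_itvW. Qed.

Lemma Rintegral_open01 (f : R -> R) : leb.-integrable `[0, 1] (EFin \o f) ->
  \int[leb]_(u in `]0, 1[) f u = \int[leb]_(u in `[0, 1]) f u.
Proof.
move=> fi; rewrite Rintegral_itv_bndo_bndc; last exact: integrable_open01.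
rewrite Rintegral_itv_obnd_cbnd//.
by apply: integrableS fi => //; apply: subset_itv; rewrite bnd_simp.
Qed.

(** Both ends of the unit interval have to be discarded: at 0 the quantile is
    a limit instead of an infimum, and at 1 the projection of a
    spectrum may take any value above its last step. *)
Lemma spectral_riskE Z (sg : R -> R) : finitely_valued Z -> risk_spectrum sg ->
  spectral_risk P sg Z =
    \int[leb]_(u in `]0, 1[) (left_quantile P Z u * sg u).
Proof.
move=> fZ [_ _ isg _].
have isg' : leb.-integrable `]0, 1] (EFin \o sg).
  by apply: integrableS isg => //; apply: subset_itv; rewrite bnd_simp.
have ilq := integrable_left_quantile_mul fZ (measurable_itv `]0, 1])
  (@subset_refl _ _) isg'.
have qE (u : R) : u \in `]0, 1]%classic ->
    left_quantile P Z u * sg u = quantile P Z u * sg u.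
  by move=> /set_mem; rewrite /= in_itv/= => /andP[u0 _]; rewrite quantileE.
rewrite Rintegral_itv_bndo_bndc; last first.
  by apply: integrableS ilq => //; apply: subset_itv; rewrite bnd_simp.
rewrite (eq_Rintegral leb qE) Rintegral_itv_obnd_cbnd//.
apply: eq_integrable ilq => // u /qE uE.
by rewrite /= uE.
Qed.

Lemma Rintegral_norm_le (f g : R -> R) :
  leb.-integrable `]0, 1[ (EFin \o f) -> leb.-integrable `]0, 1[ (EFin \o g) ->
  (forall u, 0 < u < 1 -> `|f u| <= g u) ->
  `|\int[leb]_(u in `]0, 1[) f u| <= \int[leb]_(u in `]0, 1[) g u.
Proof.
move=> fi gi fg; apply: (le_trans (le_normr_Rintegral _ fi)) => //.
by apply: le_Rintegral => //; exact: integrable_norm.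
Qed.

(** Quantiles move by at most e, and a spectrum is a probability density. *)
Lemma spectral_risk_dist Z Z' (e : R) (sg : R -> R) :
  finitely_valued Z -> finitely_valued Z' -> risk_spectrum sg ->
  0 <= e -> (forall w, `|Z w - Z' w| <= e) ->
  `|spectral_risk P sg Z - spectral_risk P sg Z'| <= e.
Proof.
move=> fZ fZ' rsg e0 ZZ'; rewrite !spectral_riskE//.
have [sg0 _ isg sg1] := rsg; have isgo := integrable_open01 isg.
have iq X : finitely_valued X -> leb.-integrable `]0, 1[
    (EFin \o (fun u => left_quantile P X u * sg u)).
  by move=> fX; apply: integrable_left_quantile_mul => //; exact: subset_itvW.
rewrite -RintegralB; [|by []|exact: iq|exact: iq].
have -> : e = \int[leb]_(u in `]0, 1[) (e * sg u).
  by rewrite RintegralZl// Rintegral_open01// sg1 mulr1.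
apply: Rintegral_norm_le.
- exact: (integrableB _ (iq _ fZ) (iq _ fZ')).
- exact: (integrableZl _ _ isgo).
move=> u /andP[u0 u1]; have sgu : 0 <= sg u by apply: sg0; rewrite in_itv/= !ltW.
by rewrite -mulrBl normrM (ger0_norm sgu) ler_wpM2r// left_quantile_dist.
Qed.

(** The risk is linear in the spectrum with the quantile function, of modulus
    at most [Phi], as density: hence the factor [int Phi]. *)
Lemma spectral_risk_spectrum_dist Z (c : R) (sg sg' Phi : R -> R) :
  finitely_valued Z -> risk_spectrum sg -> risk_spectrum sg' ->
  leb.-integrable `[0, 1] (EFin \o Phi) ->
  (forall u, 0 < u < 1 -> `|sg u - sg' u| <= c) ->
  (forall u, 0 < u < 1 -> `|quantile P Z u| <= Phi u) ->
  `|spectral_risk P sg Z - spectral_risk P sg' Z|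
    <= c * \int[leb]_(u in `[0, 1]) Phi u.
Proof.
move=> fZ rsg rsg' iPhi sgc qPhi; rewrite !spectral_riskE//.
have iPhio := integrable_open01 iPhi.
have iq s : risk_spectrum s -> leb.-integrable `]0, 1[
    (EFin \o (fun u => left_quantile P Z u * s u)).
  move=> [_ _ /integrable_open01 is_ _].
  by apply: integrable_left_quantile_mul => //; exact: subset_itvW.
rewrite -RintegralB; [|by []|exact: iq|exact: iq].
rewrite -Rintegral_open01// -RintegralZl//.
apply: Rintegral_norm_le.
- exact: (integrableB _ (iq _ rsg) (iq _ rsg')).
- exact: (integrableZl _ _ iPhio).
move=> u u01; rewrite -mulrBr normrM mulrC ler_pM//; first exact: sgc.
by have /andP[u0 _] := u01; rewrite -quantileE//; exact: qPhi.
Qed.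

End Quantile.

(** * Projection of a Lipschitz spectrum *)

Section Projection.
Context {R : realType}.
Variables (J : nat) (z : nat -> R).
Variable hz : breakpoints J z.

Lemma breakpoints_le i j : (i <= j)%N -> (j <= J.+1)%N -> z i <= z j.
Proof.
case: hz => _ _ zS /subnKC <-; elim: (j - i)%N => [|k IH]; first by rewrite addn0.
by rewrite addnS ltnS => ikJ; rewrite (le_trans (IH (leqW ikJ)))// ltW// zS.
Qed.

Lemma breakpoints_in01 j : (j <= J.+1)%N -> z j \in `[0, 1].
Proof.
case: (hz) => z0 z1 _ jJ.
by rewrite in_itv/= -{1}z0 -z1 !breakpoints_le.
Qed.

Lemma breakpoints_cover (u : R) : 0 <= u < 1 ->
  exists2 j, (j <= J)%N & u \in `[z j, z j.+1[.
Proof.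
case: (hz) => z0 z1 _ /andP[u0 u1].
suff H k : u < z k -> exists2 j, (j < k)%N & u \in `[z j, z j.+1[.
  have /H[j jJ uj] : u < z J.+1 by rewrite z1.
  by exists j.
elim: k => [|k IH] uk; first by move: uk; rewrite z0 ltNge u0.
have [/IH[j jk uj]|ku] := ltP u (z k); first by exists j => //; exact: leqW.
by exists k => //; rewrite in_itv/= ku.
Qed.

Lemma lipschitz_modulus_ge0 (L : R) (f : R -> R) :
  L.-lipschitz_(`[0, 1]) f -> 0 <= L.
Proof.
move=> /(_ (1, 0)) /=; rewrite subr0 normr1 mulr1 => fL.
by apply: le_trans (fL _) => //; split; rewrite /= in_itv/= ?lexx ?ler01.
Qed.

(** On the cell containing u, monotonicity places both values between
    [sg (z j)] and [sg (z j.+1)].  The point 1 belongs to no cell. *)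
Lemma spectrum_projection_dist (L : R) (sg sgJ : R -> R) :
  risk_spectrum sg -> L.-lipschitz_(`[0, 1]) sg ->
  spectrum_projection J z sg sgJ ->
  forall u, 0 <= u < 1 -> `|sgJ u - sg u| <= L * mesh J z.
Proof.
move=> [_ sgm _ _] sgL [_ [a [stp ba _]]] u u01.
have [j jJ uj] := breakpoints_cover u01.
have zj := breakpoints_in01 (leqW jJ).
have zj1 : z j.+1 \in `[0, 1] by exact: breakpoints_in01.
have /andP[zu uz] : z j <= u < z j.+1 by move: uj; rewrite in_itv.
have ui : u \in `[0, 1] by rewrite in_itv/=; case/andP: u01 => -> /ltW ->.
rewrite (stp j jJ u uj); have /andP[sa as_] := ba j jJ.
have s1 := sgm _ _ zj ui zu; have s2 := sgm _ _ ui zj1 (ltW uz).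
have L0 := lipschitz_modulus_ge0 sgL.
have {}sgL : sg (z j.+1) - sg (z j) <= L * (z j.+1 - z j).
  apply: (le_trans (ler_norm _)); apply: le_trans (sgL (z j.+1, z j) _) _ => //=.
  by rewrite ger0_norm// subr_ge0 breakpoints_le.
have : L * (z j.+1 - z j) <= L * mesh J z.
  rewrite ler_wpM2l//.
  exact: (le_bigmax 0 (fun j : 'I_J.+1 => z j.+1 - z j) (@Ordinal J.+1 j jJ)).
by move=> h; rewrite ler_norml; apply/andP; split; lra.
Qed.

Lemma mesh_ge0 : 0 <= mesh J z.
Proof. exact: bigmax_ge_id. Qed.

End Projection.

(** * Worst-case risk *)

Section WorstCase.
Context {d : measure_display} {Omega : measurableType d} {R : realType}.
Variable P : probability Omega R.

(** The two effects add up through the intermediate risk of [Z'] under [sg]: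
    first the cost changes with the spectrum fixed, then the spectrum with the
    cost fixed.  Taken in this order, the quantile bound bears on [Z'], which will be
    the cost-to-go with the original spectra. *)
Lemma worst_case_risk_dist (N : nat -> nat) (ds : nat)
    (s : forall t, 'I_(N t) -> 'cV[R]_ds) (Q : forall t, set ('I_(N t) -> R))
    (sg sg' : 'cV[R]_ds -> R -> R) (t : nat) (Z Z' : Omega -> R)
    (Phi : R -> R) (c e : R) :
  finitely_valued Z -> finitely_valued Z' ->
  (forall nu, risk_spectrum (sg (s t nu))) ->
  (forall nu, risk_spectrum (sg' (s t nu))) ->
  (forall q, Q t q -> (forall nu, 0 <= q nu) /\ \sum_nu q nu = 1) ->
  lebesgue_measure.-integrable `[0, 1] (EFin \o Phi) ->
  (forall u, 0 < u < 1 -> `|quantile P Z' u| <= Phi u) ->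
  0 <= c -> (forall nu u, 0 < u < 1 -> `|sg (s t nu) u - sg' (s t nu) u| <= c) ->
  0 <= e -> (forall w, `|Z w - Z' w| <= e) ->
  `|worst_case_risk P s Q sg t Z - worst_case_risk P s Q sg' t Z'|
    <= c * \int[lebesgue_measure]_(u in `[0, 1]) Phi u + e.
Proof.
move=> fZ fZ' rsg rsg' simplex iPhi qPhi c0 sgc e0 ZZ'.
have Phi0 : 0 <= \int[lebesgue_measure]_(u in `[0, 1]) Phi u.
  rewrite -Rintegral_open01//; apply: Rintegral_ge0 => u.
  by rewrite /= in_itv/= => /qPhi; exact: le_trans.
apply: dist_sup_image => [|q /simplex[q0 q1]]; first by rewrite addr_ge0 ?mulr_ge0.
apply: dist_convex_sum => // nu.
rewrite [leRHS]addrC -(subrKA (spectral_risk P (sg (s t nu)) Z')).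
apply: (le_trans (ler_normD _ _)); apply: lerD.
  exact: spectral_risk_dist.
by apply: spectral_risk_spectrum_dist => //; exact: sgc.
Qed.

End WorstCase.

(** * Backward recursion *)

Section BackwardRecursion.
Context {d : measure_display} {Omega : measurableType d} {R : realType}.
Variables (P : probability Omega R) (T : nat) (m n : nat -> nat).
Variable x0 : 'cV[R]_(n 0%N).
Variable xi : forall t, Omega -> stage_data R (m t) (n t.-1) (n t).
Variables (N : nat -> nat) (ds : nat).
Variables (s : forall t, 'I_(N t) -> 'cV[R]_ds).
Variable Q : forall t, set ('I_(N t) -> R).
Variables sg sg' : 'cV[R]_ds -> R -> R.
Variable eps : nat -> R.

Let V := cost_to_go P xi s Q sg T.
Let V' := cost_to_go P xi s Q sg' T.

Lemma feasible_next t (x : 'cV[R]_(n t.-1)) v (y : 'cV[R]_(n t)) : (0 < t)%N ->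
  feasible xi x0 x -> realizations (xi t) v -> feasible_set x v y ->
  feasible xi x0 y.
Proof. by case: t x v y => //= t x v y _ fx rv fy; exists x => //; exists v. Qed.

(** Propagation of the errors: an estimate of the worst-case risk with an error
    [eps t.+1] of its own, uniform over the feasible decisions, accumulates
    additively over the stages. *)
Lemma cost_to_go_dist :
  (forall t, (2 <= t <= T)%N -> 0 <= eps t) ->
  (forall t (y : 'cV[R]_(n t)) (e : R), (1 <= t < T)%N -> feasible xi x0 y ->
     0 <= e ->
     (forall w, `|@V t.+1 y (xi t.+1 w) - @V' t.+1 y (xi t.+1 w)| <= e) ->
     `|worst_case_risk P s Q sg t.+1 (fun w => @V t.+1 y (xi t.+1 w)) -
       worst_case_risk P s Q sg' t.+1 (fun w => @V' t.+1 y (xi t.+1 w))|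
       <= eps t.+1 + e) ->
  forall t, (1 <= t <= T)%N -> forall (x : 'cV[R]_(n t.-1)) v,
    feasible xi x0 x -> realizations (xi t) v ->
    `|@V t x v - @V' t x v| <= \sum_(t.+1 <= t' < T.+1) eps t'.
Proof.
move=> eps0 step t /andP[t0 tT].
have sum0 k : (0 < k)%N -> 0 <= \sum_(k.+1 <= t' < T.+1) eps t'.
  move=> k0; rewrite big_nat_cond; apply: sumr_ge0 => t' /andP[/andP[kt t'T] _].
  by apply: eps0; rewrite -[(t' <= T)%N]ltnS t'T (leq_trans _ kt).
move: tT; have [k] := ubnP (T - t)%N; elim: k t t0 => // k IH t t0 tk tT x v fx rv.
have [Tt|tltT] := leqP T t.
  have tE : t = T by apply/eqP; rewrite eqn_leq tT.
  subst t.
  by rewrite /V /V' !cost_to_go_last subrr normr0; exact: sum0.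
rewrite /V /V' !cost_to_go_rec//; apply: dist_inf_image; first exact: sum0.
move=> y /(feasible_next t0 fx rv) fy.
rewrite opprD addrACA subrr add0r big_ltn//; apply: step => //; first by rewrite t0.
  exact: sum0.
move=> w; apply: IH => //.
  by rewrite -ltnS (leq_trans _ tk)// ltnS ltn_sub2l.
by exists w.
Qed.

End BackwardRecursion.

(** * Error bound for the step approximation *)

Theorem theorem4p3
  (R : realType) (d : measure_display) (Omega : measurableType d)
  (P : probability Omega R)
  (J : nat) (z : nat -> R) (hz : breakpoints J z)
  (T : nat) (hT : (1 < T)%N)
  (m n : nat -> nat) (x0 : 'cV[R]_(n 0%N))
  (xi : forall t, Omega -> stage_data R (m t) (n t.-1) (n t))
  (hxi_fin : forall t, (1 <= t <= T)%N -> finitely_valued (xi t))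
  (hxi1 : exists v, forall w, xi 1%N w = v)
  (hxi_indep : independent_upto P T xi)
  (hX : forall t, (1 <= t <= T)%N -> forall (x : 'cV[R]_(n t.-1)) v,
     feasible xi x0 x -> realizations (xi t) v ->
     feasible_set x v !=set0 /\ compact (feasible_set x v))
  (N : nat -> nat) (ds : nat) (s : forall t, 'I_(N t) -> 'cV[R]_ds)
  (mu : nat -> 'cV[R]_ds) (Sigma : nat -> 'M[R]_ds)
  (hs : forall t, (2 <= t <= T)%N -> injective (s t))
  (hQ : forall t, (2 <= t <= T)%N ->
     ambiguity_set (s t) (mu t) (Sigma t) !=set0)
  (sigma hsigma : 'cV[R]_ds -> R -> R) (L : forall t, 'I_(N t) -> R)
  (hsig : forall t, (2 <= t <= T)%N -> forall nu : 'I_(N t),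
     [/\ risk_spectrum (sigma (s t nu)),
         (L t nu).-lipschitz_(`[0, 1]) (sigma (s t nu))
       & spectrum_projection J z (sigma (s t nu)) (hsigma (s t nu))])
  (Phi : nat -> R -> R)
  (hPhi_pos : forall t, (1 <= t <= T)%N ->
     forall u : R, u \in `[0, 1] -> 0 < Phi t u)
  (hPhi_int : forall t, (1 <= t <= T)%N ->
     lebesgue_measure.-integrable `[0, 1] (EFin \o Phi t)) :
  let Q := fun t => ambiguity_set (s t) (mu t) (Sigma t) in
  let V := cost_to_go P xi s Q hsigma T in
  let Vt := cost_to_go P xi s Q sigma T in
  (forall t, (1 <= t <= T)%N -> forall x : 'cV[R]_(n t.-1),
     feasible xi x0 x ->
     forall u : R, u \in `[0, 1] ->
       `|quantile P (fun w => Vt t x (xi t w)) u| <= Phi t u) ->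
  forall t, (1 <= t <= T)%N -> forall (x : 'cV[R]_(n t.-1)) v,
    feasible xi x0 x -> realizations (xi t) v ->
    `|V t x v - Vt t x v| <=
      \sum_(t.+1 <= t' < T.+1)
        (\big[Num.max/0]_(nu < N t') L t' nu) * mesh J z *
        \int[lebesgue_measure]_(u in `[0, 1]) Phi t' u.
Proof.
move=> Q V Vt hPhi.
have nonneg_L t (nu : 'I_(N t)) : (2 <= t <= T)%N -> 0 <= L t nu.
  by move=> /hsig /(_ nu)[_ /lipschitz_modulus_ge0].
have Phi0 t : (2 <= t <= T)%N ->
    0 <= \int[lebesgue_measure]_(u in `[0, 1]) Phi t u.
  move=> /andP[t2 tT]; apply: Rintegral_ge0 => u u01.
  by apply/ltW/hPhi_pos => //; rewrite tT (ltnW t2).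
have maxL0 t : 0 <= \big[Num.max/0]_(nu < N t) L t nu by exact: bigmax_ge_id.
apply: cost_to_go_dist => [t tT|t y e /andP[t1 tT] fy e0 dV].
  by rewrite !mulr_ge0 ?mesh_ge0 ?Phi0.
have t1T : (1 <= t.+1 <= T)%N by rewrite /= tT.
have t2T : (2 <= t.+1 <= T)%N by rewrite ltnS t1.
apply: worst_case_risk_dist => //.
- exact: finitely_valued_comp (hxi_fin _ t1T).
- exact: finitely_valued_comp (hxi_fin _ t1T).
- by move=> nu; have [_ _ [[]]] := hsig _ t2T nu.
- by move=> nu; have [] := hsig _ t2T nu.
- by move=> q [].
- exact: hPhi_int.
- by move=> u /andP[u0 u1]; apply: hPhi => //; rewrite in_itv/= !ltW.
- by rewrite mulr_ge0// mesh_ge0.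
move=> nu u /andP[u0 u1]; have [rsg lsg psg] := hsig _ t2T nu.
apply: (le_trans (spectrum_projection_dist hz rsg lsg psg _)).
  by rewrite u1 ltW.
by rewrite ler_wpM2r ?mesh_ge0// le_bigmax.
Qed.
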